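(* Let $\alpha\approx 1.6180$ be the positive root of $x^2-x-1$ and let $\beta\approx 2.3644$ be the positive root of $4x^4-125$. For each $n$ let $g=g_0+g_1x+\cdots+g_nx^n$ be a generic polynomial of degree $n$, and let $f_0+f_1x+f_2x^2$ be a generic quadratic polynomial (all $f_i,g_j$ are independent indeterminates). Then $$H\big(\mathrm{Res}(f_0+f_1x+f_2x^2,\,g)\big)=\frac{\beta}{\sqrt{n\pi}}\,\alpha^n-\mathcal{O}\!\left(\frac{\alpha^n}{n\sqrt n}\right),$$ where $\mathcal{O}$ is the two-sided notion given in the context; that is, the sequence $E(n)=\frac{\beta}{\sqrt{n\pi}}\alpha^n-H(\mathrm{Res}(f_0+f_1x+f_2x^2,g))$ satisfies $E(n)=\mathcal{O}\big(\frac{\alpha^n}{n\sqrt n}\big)$.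
   Context: For $f=f_0+\cdots+f_mx^m$ and $g=g_0+\cdots+g_nx^n$ with indeterminate coefficients, $\mathrm{Res}(f,g)$ is the Sylvester resultant: the determinant of the $(m+n)\times(m+n)$ matrix whose first $n$ columns are successive downward shifts of the coefficient vector of $f$ (for $1\le j\le n$, column $j$ has entry $f_i$ in row $i+j$, $0\le i\le m$, and zeros elsewhere) and whose last $m$ columns are successive downward shifts of the coefficient vector of $g$ (for $1\le j\le m$, column $n+j$ has entry $g_i$ in row $i+j$, $0\le i\le n$, and zeros elsewhere). It is a polynomial with integer coefficients in the variables $f_i,g_j$. The height of a polynomial $P=\sum_\alpha c_\alpha U^\alpha\in\mathbb{C}[U_1,\dots,U_p]$ is $H(P)=\max_\alpha|c_\alpha|$. Convention for $\mathcal{O}$ (non-standard, two-sided): for a positive sequence $a(n)$, a sequence $b(n)$ satisfies $b(n)=\mathcal{O}(a(n))$ if there exist positive constants $c_1,c_2$ and $N$ such that $c_1a(n)\le b(n)\le c_2a(n)$ for all $n>N$. *)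

(* Defs.v *)
From mathcomp Require Import all_boot all_order all_algebra.
From mathcomp Require Import mpoly.

Set Implicit Arguments.
Unset Strict Implicit.
Unset Printing Implicit Defensive.

Import Order.TTheory GRing.Theory Num.Theory.

Local Open Scope ring_scope.

(* Column j holds the vector a shifted down by j: entry a_k in row k + j. *)
Definition shift_mx (K : nzRingType) (N d c : nat) (a : 'I_d.+1 -> K) :
    'M[K]_(N, c) :=
  \matrix_(i < N, j < c) \sum_(k < d.+1 | i == (k + j)%N :> nat) a k.

Definition sylvester (K : nzRingType) (m n : nat)
    (f : 'I_m.+1 -> K) (g : 'I_n.+1 -> K) : 'M[K]_(n + m) :=
  row_mx (shift_mx (n + m) n f) (shift_mx (n + m) m g).

(* The matrix is the transpose of MathComp's Sylvester_mx; taking the formal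
   degrees m and n as parameters avoids computing polynomial sizes. *)
Lemma det_sylvester (K : comNzRingType) (m n : nat) (p q : {poly K}) :
  size p = m.+1 -> size q = n.+1 ->
  \det (sylvester (fun i : 'I_m.+1 => p`_i) (fun j : 'I_n.+1 => q`_j)) =
  resultant p q.
Proof.
have shiftE N d c (r : {poly K}) (i : 'I_N) (j : 'I_c) : size r = d.+1 ->
    shift_mx N c (fun k : 'I_d.+1 => r`_k) i j = r`_(i - j) *+ (j <= i).
  move=> sr; rewrite mxE; case: leqP => [le_ji | lt_ij]; last first.
    rewrite big1 // => k /eqP eik.
    by move: lt_ij; rewrite eik ltnNge leq_addl.
  case: (ltnP (i - j) d.+1) => [lt_d | ge_d].
    rewrite (big_pred1 (Ordinal lt_d)) // => k /=.
    by rewrite -val_eqE /= -(eqn_add2r j k) subnK // eq_sym.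
  rewrite nth_default ?sr // big1 // => k /eqP eik.
  by move: ge_d; rewrite eik addnK leqNgt ltn_ord.
move=> sp sq.
have [em en] : m = (size p).-1 /\ n = (size q).-1 by rewrite sp sq.
rewrite -det_tr /resultant.
move: sp sq; rewrite {}em {}en => sp sq; congr (\det _).
apply/matrixP => i j; rewrite Sylvester_mxE mxE /sylvester mxE.
by case: splitP => k _; rewrite shiftE.
Qed.

(* f_0, ..., f_m are the first m + 1 variables and g_0, ..., g_n the last
   n + 1 ones. *)
Definition Res (m n : nat) : {mpoly int[m.+1 + n.+1]} :=
  \det (sylvester (fun i : 'I_m.+1 => 'X_(lshift n.+1 i))
                  (fun j : 'I_n.+1 => 'X_(rshift m.+1 j))).

(* Valid over any subring K of the complex numbers. *)
Definition height (K : numDomainType) (p : nat) (P : {mpoly K[p]}) : K :=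
  \big[Num.max/0]_(u <- msupp P) `|P@_u|.

Definition two_sided_O (R : realFieldType) (b a : nat -> R) : Prop :=
  exists c1 c2 : R, exists N : nat,
    [/\ 0 < c1, 0 < c2 &
        forall n : nat, (N < n)%N -> c1 * a n <= b n <= c2 * a n].

(* Main.v *)
Require Import Defs.
From mathcomp Require Import all_boot all_order all_algebra.
From mathcomp Require Import ring lra zify.
From mathcomp Require mpoly.
From mathcomp Require Import reals trigo.

(** Let xi and eta be the roots of f, so that Res(f, g) = f_2^n g(xi) g(eta).
    The coefficient of g_i g_j with i < j is f_0^i f_2^(n-j) V_(j-i), where
    V_k = f_2^k (xi^k + eta^k) is a Lucas polynomial in f_1 and f_0 f_2.  All
    the monomials obtained this way are distinct, hence the height is the
    maximum over r of n/(n-r) C(n-r, r).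

    Comparing neighbouring values, a maximiser is r = mu n + x with
    mu = (1 - 1/sqrt 5)/2 and x bounded.  Stirling's formula with its 1/(12 m)
    correction then gives
      H = beta/sqrt(n pi) alpha^n exp(- q(x)/n + O(1/n^2)),
      q(x) = (sqrt 5/2) (5 x^2 - x + 1/3),
    and the quadratic polynomial q has negative discriminant, so that it is
    bounded below by a positive constant, whatever the value of x. *)

Import Order.TTheory GRing.Theory Num.Theory.

Local Open Scope ring_scope.

(** * The resultant with a quadratic polynomial *)

Lemma sum_shift_mx (K : comNzRingType) (N d c : nat) (w : nat -> K)
    (a : 'I_d.+1 -> K) (j : 'I_c) :
  (d + j < N)%N ->
  \sum_(t < N) w t * shift_mx N c a t j = \sum_k a k * w (k + j)%N.
Proof.
move=> lt_dj.
under eq_bigr => t _ do rewrite mxE mulr_sumr.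
rewrite (exchange_big_dep predT) //=; apply: eq_bigr => k _.
have lt_kj : (k + j < N)%N.
  by apply: leq_ltn_trans lt_dj; rewrite leq_add2r -ltnS ltn_ord.
rewrite (big_pred1 (Ordinal lt_kj)) => [|t]; first by rewrite mulrC.
by [].
Qed.

Lemma det_mx22 (K : comNzRingType) (A : 'M[K]_2) :
  \det A = A 0 0 * A 1 1 - A 0 1 * A 1 0.
Proof.
rewrite (expand_det_row _ 0) !big_ord_recl big_ord0 addr0 /cofactor !det_mx11.
rewrite !mxE /=.
have -> : lift 0 0 = 1 :> 'I_2 by apply: val_inj.
have -> : lift (1 : 'I_2) 0 = 0 :> 'I_2 by apply: val_inj.
by rewrite /= addn0 addn1 expr0 expr1 mul1r mulN1r mulrN.
Qed.

Lemma sum_sym_pairs (V : nmodType) (n : nat) (T : 'I_n -> 'I_n -> V) :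
  \sum_i \sum_j T i j =
  \sum_(i < n) \sum_(j < n | (i <= j)%N)
    (if i == j then T i i else T i j + T j i).
Proof.
transitivity (\sum_(i < n) (\sum_(j < n | (i <= j)%N) T i j
                            + \sum_(j < n | (i < j)%N) T j i)).
  rewrite big_split /= [X in _ + X](exchange_big_dep predT) //= -big_split /=.
  apply: eq_bigr => i _.
  rewrite [LHS](bigID (fun j : 'I_n => i <= j)%N) /=; congr (_ + _).
  by apply: eq_bigl => j; rewrite ltnNge.
apply: eq_bigr => i _.
rewrite (bigD1 i) //= [RHS](bigD1 i) //= eqxx -addrA; congr (_ + _).
transitivity (\sum_(j < n | (i <= j)%N && (j != i)) (T i j + T j i)).
  rewrite big_split /=; congr (_ + _); apply: eq_bigl => j.
  by rewrite ltn_neqAle eq_sym andbC.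
by apply: eq_bigr => j /andP[_ /negbTE]; rewrite eq_sym => ->.
Qed.

(** [lrec P Q 0 1] is the Lucas sequence of the first kind with parameters P and Q. Advancing the
    pair of initial values makes [lrecSS] a direct induction. *)
Fixpoint lrec {K : nzRingType} (P Q u v : K) (k : nat) : K :=
  if k is k'.+1 then lrec P Q v (P * v - Q * u) k' else u.

Lemma lrecSS (K : nzRingType) (P Q u v : K) (k : nat) :
  lrec P Q u v k.+2 = P * lrec P Q u v k.+1 - Q * lrec P Q u v k.
Proof. by elim: k u v => // k IH u v; exact: IH. Qed.

(** For d = 1 this is the Casoratian of two solutions, which gains a factor Q at each step. Both
    sides satisfy the same second-order recurrence in d, so two consecutive values of d carry the
    induction. *)
Lemma lrec_casoratian (K : comNzRingType) (P Q : K) (q d : nat) :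
  lrec P Q 0 1 (d + q) * lrec P Q 1 0 q - lrec P Q 0 1 q * lrec P Q 1 0 (d + q)
  = Q ^+ q * lrec P Q 0 1 d.
Proof.
have c1 : lrec P Q 0 1 q.+1 * lrec P Q 1 0 q -
          lrec P Q 0 1 q * lrec P Q 1 0 q.+1 = Q ^+ q.
  elim: q => [|q IH]; first by rewrite /= expr0; ring.
  by rewrite exprS -IH !lrecSS; ring.
suff [] : lrec P Q 0 1 (d + q) * lrec P Q 1 0 q
          - lrec P Q 0 1 q * lrec P Q 1 0 (d + q) = Q ^+ q * lrec P Q 0 1 d
       /\ lrec P Q 0 1 (d.+1 + q) * lrec P Q 1 0 q
          - lrec P Q 0 1 q * lrec P Q 1 0 (d.+1 + q) =
            Q ^+ q * lrec P Q 0 1 d.+1.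
  by [].
elim: d => [|d [IH1 IH2]].
  by split; [rewrite add0n mulr0 mulrC subrr | rewrite add1n c1 /= mulr1].
split=> //; rewrite !addSn !lrecSS; rewrite !addSn in IH2.
rewrite [RHS]mulrBr [Q ^+ q * (P * _)]mulrCA [Q ^+ q * (Q * _)]mulrCA -IH1 -IH2.
by ring.
Qed.

(* At P = - f1 and Q = f0 * f2 this is f2^k (xi^k + eta^k) for k > 0, where xi
   and eta are the roots of f, but 1 and not 2 for k = 0: the square g_i^2
   occurs only once in g(xi) g(eta). *)
Definition lucas_pol {K : nzRingType} (P Q : K) (k : nat) : K :=
  if k is k'.+1 then lrec P Q 0 1 k'.+2 - Q * lrec P Q 0 1 k' else 1.

Section SylvesterQuadratic.
Variables (K : idomainType) (n : nat) (f : 'I_3 -> K) (g : 'I_n.+1 -> K).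

Let f0 := f 0. Let f1 := f 1. Let f2 := f 2%:R.
Let U := lrec (- f1) (f0 * f2) 0 1.
Let B := lrec (- f1) (f0 * f2) 1 0.

(* The rows (row_seq u t)_t, for u = U or u = B, annihilate the n shifts of f, so that
   after multiplication by an explicit block triangular matrix the Sylvester
   matrix becomes block triangular with a 2 x 2 corner. *)
Let row_seq (u : nat -> K) (t : nat) : K := f0 ^+ t * u (n.+1 - t)%N.

(** With N = n + 1 - j, the sum is f0^(j+1) (u_N + f1 u_(N-1) + f0 f2 u_(N-2)), which the recurrence
    makes zero; j < n ensures N >= 2. *)
Lemma row_seq_annihilates u v (j : nat) : (j < n)%N ->
  \sum_k f k * row_seq (lrec (- f1) (f0 * f2) u v) (k + j) = 0.
Proof.
move=> lt_jn; rewrite !big_ord_recl big_ord0 addr0 /row_seq /=.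
rewrite /bump /= !add0n !addn0 !add1n.
have -> : (n.+1 - j = (n.+1 - j.+2).+2)%N by lia.
have -> : (n.+1 - j.+1 = (n.+1 - j.+2).+1)%N by lia.
rewrite lrecSS.
have -> : f ord0 = f0 by [].
have -> : f (lift ord0 ord0) = f1 by congr f; apply: val_inj.
have -> : f (lift ord0 (lift ord0 ord0)) = f2 by congr f; apply: val_inj.
rewrite !exprS; ring.
Qed.

Let X : 'M[K]_(2, n + 2) :=
  \matrix_(i, t) row_seq (if i == 0 then U else B) t.

Let W : 'M[K]_(n + 2) := col_mx (row_mx 1%:M 0) X.

(** U and B take the values 0, 1 and 1, 0 at the indices 0 and 1, so the last two columns of [X]
    form a diagonal matrix with entries f0^n and f0^(n+1). *)
Lemma det_transform : \det W = f0 ^+ n * f0 ^+ n.+1.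
Proof.
have -> : W = block_mx 1%:M 0 (lsubmx X) (rsubmx X)
  by rewrite /block_mx hsubmxK.
rewrite det_lblock det1 mul1r.
rewrite det_mx22 !mxE /= /row_seq.
have -> : (n.+1 - (n + 0) = 1)%N by lia.
have -> : (n.+1 - (n + 1) = 0)%N by lia.
by rewrite /U /B /= !addn0 !addn1; ring.
Qed.

Let S1 := shift_mx (n + 2) n f.
Let S2 := shift_mx (n + 2) 2 g.

Lemma det_usubmx_shift : \det (usubmx S1) = f0 ^+ n.
Proof.
rewrite det_trig; last first.
  apply/is_trig_mxP => i j lt_ij; rewrite !mxE big1 // => k /eqP /= eik.
  by move: lt_ij; rewrite eik ltnNge leq_addl.
rewrite (eq_bigr (fun=> f0)) => [|i _]; first by rewrite prodr_const card_ord.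
rewrite !mxE (big_pred1 0) // => k /=.
by rewrite -[X in X == _]add0n eqn_add2r eq_sym.
Qed.

Lemma X_mul_S1 : X *m S1 = 0.
Proof.
apply/matrixP => i j; rewrite [LHS]mxE [RHS]mxE.
under eq_bigr => t _ do rewrite [X _ _]mxE.
rewrite sum_shift_mx; last by rewrite addnC ltn_add2r.
by case: ifP => _; rewrite row_seq_annihilates.
Qed.

Let pairing (u : nat -> K) (e : nat) := \sum_k g k * row_seq u (k + e).

Lemma X_mul_S2 (i j : 'I_2) :
  (X *m S2) i j = pairing (if i == 0 then U else B) j.
Proof.
rewrite mxE.
under eq_bigr => t _ do rewrite [X _ _]mxE.
by rewrite sum_shift_mx // ltn_add2l.
Qed.

(** [W] times the Sylvester matrix is block upper triangular: [X_mul_S1] kills the lower left block,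
    the upper left one is triangular with f0 on its diagonal, and the 2 x 2 corner is [X *m S2]. *)
Lemma det_transform_mul :
  f0 ^+ n * f0 ^+ n.+1 * \det (sylvester f g) =
  f0 ^+ n * (pairing U 0 * pairing B 1 - pairing U 1 * pairing B 0).
Proof.
have -> : pairing U 0 * pairing B 1 - pairing U 1 * pairing B 0 =
          \det (X *m S2) by rewrite det_mx22 !X_mul_S2.
rewrite -det_transform -det_usubmx_shift -det_mulmx.
rewrite /W /sylvester mul_mx_row !mul_col_mx -/S1 -/S2 X_mul_S1.
rewrite -[in row_mx 1%:M 0 *m S1](vsubmxK S1) mul_row_col mul1mx mul0mx addr0.
by rewrite -block_mxEh det_ublock.
Qed.

(** The 2 x 2 determinant is bilinear in g with Casoratians as coefficients. For i < j and k + 1 = j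
    - i, the terms of (i, j) and (j, i) contribute U at k + 2 and U at k, which combine into a Lucas
    polynomial. *)
Lemma pairing_det :
  pairing U 0 * pairing B 1 - pairing U 1 * pairing B 0 =
  f0 ^+ n.+1 *
  \sum_(i < n.+1) \sum_(j < n.+1 | (i <= j)%N)
     g i * g j * (f0 ^+ i * f2 ^+ (n - j)
                  * lucas_pol (- f1) (f0 * f2) (j - i)).
Proof.
pose c (p q : nat) : K := U p * B q - U q * B p.
pose T (i j : 'I_n.+1) :=
  g i * g j * f0 ^+ (i + j.+1) * c (n.+1 - i)%N (n - j)%N.
transitivity (\sum_i \sum_j T i j).
  rewrite [pairing U 1 * _]mulrC !big_distrlr -sumrB; apply: eq_bigr => i _.
  rewrite -sumrB; apply: eq_bigr => j _.
  by rewrite /T /c /row_seq /= !addn0 !addn1 !subSS exprD; ring.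
rewrite sum_sym_pairs mulr_sumr; apply: eq_bigr => i _.
rewrite mulr_sumr; apply: eq_bigr => j le_ij.
have le_jn : (j <= n)%N by rewrite -ltnS.
have cE p q : (q <= p)%N -> c p q = (f0 * f2) ^+ q * U (p - q).
  by move=> le_qp; rewrite /U -lrec_casoratian subnK.
have expf0 : f0 ^+ n.+1 = f0 ^+ j.+1 * f0 ^+ (n - j).
  by rewrite -exprD; congr (_ ^+ _); lia.
case: eqP => [eij|/eqP neij].
  rewrite -eij in le_jn expf0 *.
  rewrite /T cE; last by lia.
  have -> : (n.+1 - i - (n - i) = 1)%N by lia.
  rewrite subnn /= exprMn expf0 exprD; rewrite /U /=; ring.
have lt_ij : (i < j)%N by rewrite ltn_neqAle neij.
have [k ek] : exists k, (j - i)%N = k.+1.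
  by exists (j - i).-1; rewrite prednK // subn_gt0.
rewrite ek /T /=.
rewrite cE; last by lia.
(* For i < j one has n + 1 - j <= n - i; antisymmetry puts the indices in the order that [cE]
   requires. *)
have -> : c (n.+1 - j)%N (n - i)%N = - c (n - i)%N (n.+1 - j)%N.
  by rewrite /c; ring.
rewrite cE; last by lia.
have -> : (n.+1 - i - (n - j) = k.+2)%N by lia.
have -> : (n - i - (n.+1 - j) = k)%N by lia.
have -> : (n.+1 - j = (n - j).+1)%N by lia.
rewrite expf0 !exprD !exprMn -/U !exprS; rewrite /U; ring.
Qed.

Lemma det_sylvester_quadratic : f 0 != 0 ->
  \det (sylvester f g) =
  \sum_(i < n.+1) \sum_(j < n.+1 | (i <= j)%N)
     g i * g j * (f 0 ^+ i * f 2%:R ^+ (n - j)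
                  * lucas_pol (- f 1) (f 0 * f 2%:R) (j - i)).
Proof.
move=> f0_neq0; apply: (@mulfI _ (f0 ^+ n * f0 ^+ n.+1)).
  by rewrite mulf_neq0 ?expf_neq0.
by rewrite det_transform_mul pairing_det mulrA.
Qed.
End SylvesterQuadratic.

(** * Coefficients of the Lucas polynomials *)

(** For 2r <= k and k > 0 this is k/(k-r) C(k-r, r), an entry of the Lucas triangle. The sum of two
    binomials avoids the division and is visibly monotone in k. *)
Definition lucas_coef (k r : nat) : nat :=
  'C(k - r, r) + (if r is r'.+1 then 'C(k - r'.+2, r') else 0).

(** Pascal's rule matches the recurrence. Terms with 2r > k have a zero binomial, so their truncated
    exponents are harmless. *)
Lemma lrec_bin (K : comNzRingType) (P Q : K) (k : nat) :
  lrec P Q 0 1 k.+1 =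
  \sum_(r < k.+1) (-1) ^+ r * P ^+ (k - r.*2) * Q ^+ r *+ 'C(k - r, r).
Proof.
suff [] : lrec P Q 0 1 k.+1 =
    \sum_(r < k.+1) (-1) ^+ r * P ^+ (k - r.*2) * Q ^+ r *+ 'C(k - r, r) /\
  lrec P Q 0 1 k.+2 =
    \sum_(r < k.+2) (-1) ^+ r * P ^+ (k.+1 - r.*2) * Q ^+ r *+ 'C(k.+1 - r, r)
  by [].
elim: k => [|k [IH1 IH2]].
  by rewrite !big_ord_recl !big_ord0 /= !expr0 ?mulr1n ?mulr0n; split; ring.
split=> //; rewrite lrecSS IH1 IH2 {IH1 IH2}.
rewrite big_ord_recl [RHS]big_ord_recl [in RHS]big_ord_recr /=.
rewrite !subn0 !bin0 subnn bin0n mulr0n addr0 mulrDr -addrA.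
congr (_ + _); first by rewrite !exprS; ring.
rewrite !mulr_sumr -sumrB; apply: eq_bigr => r _.
rewrite /bump !add1n /= doubleS.
have lt_r : (r <= k)%N by rewrite -ltnS.
have -> : (k.+2 - r.+1 = (k - r).+1)%N by lia.
have -> : (k.+1 - r.+1 = k - r)%N by lia.
rewrite binS mulrnDr; congr (_ + _).
  (* When k <= 2r the exponent truncates and cannot absorb the factor P, but then the binomial
     vanishes. *)
  have [lt|le] := ltnP (k - r) r.+1; first by rewrite bin_small //
    !mulr0n mulr0.
  have -> : (k.+2 - r.*2.+2 = (k.+1 - r.*2.+2).+1)%N by lia.
  by rewrite mulrnAr; congr (_ *+ _); rewrite !exprS; ring.
have -> : (k.+2 - r.*2.+2 = k - r.*2)%N by lia.
by rewrite mulrnAr -mulNrn; congr (_ *+ _); rewrite !exprS; ring.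
Qed.

(** The condition 2r <= k excludes the spurious value [lucas_coef k 1] = 1 at k = 0 and k = 1,
    caused by truncated subtraction. The free bound N gives all degrees k the same range of
    summation. *)
Lemma lucas_polE (K : comNzRingType) (P Q : K) (k N : nat) : (k < N)%N ->
  lucas_pol P Q k =
  \sum_(r < N | (r.*2 <= k)%N)
    (-1) ^+ r * P ^+ (k - r.*2) * Q ^+ r *+ lucas_coef k r.
Proof.
move=> lt_kN.
transitivity (\sum_(r < k.+1 | (r.*2 <= k)%N)
    (-1) ^+ r * P ^+ (k - r.*2) * Q ^+ r *+ lucas_coef k r); last first.
  rewrite (big_ord_widen_cond N (fun r => (r.*2 <= k)%N)
    (fun r => (-1) ^+ r * P ^+ (k - r.*2) * Q ^+ r *+ lucas_coef k r)) //.
  by apply: eq_bigl => r; lia.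
case: k {lt_kN} => [|[|k]].
- by rewrite big_mkcond big_ord_recl big_ord0 /= expr0 addr0 !mulr1.
- rewrite big_mkcond !big_ord_recl big_ord0 /= mulr0 subr0 expr0 expr1 addr0.
  by rewrite expr0 !mulr1 mul1r subr0 addr0.
have -> : lucas_pol P Q k.+2 = lrec P Q 0 1 k.+3 - Q * lrec P Q 0 1 k.+1 by [].
rewrite !lrec_bin [RHS](_ : _ = \sum_(r < k.+3)
    (-1) ^+ r * P ^+ (k.+2 - r.*2) * Q ^+ r *+ lucas_coef k.+2 r); last first.
  rewrite [RHS](bigID (fun r : 'I_k.+3 => r.*2 <= k.+2)%N) /=.
  rewrite [X in _ + X]big1 ?addr0 // => -[[|r] lt_r] //=.
  rewrite -ltnNge doubleS !ltnS => lt_kr; rewrite /lucas_coef !bin_small //;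
    lia.
rewrite [RHS]big_ord_recl [X in X - _]big_ord_recl /= /lucas_coef !addn0 -addrA.
congr (_ + _).
under [RHS]eq_bigr => r _ do rewrite /= /bump add1n mulrnDr.
rewrite big_split /=; congr (_ + _).
rewrite [RHS]big_ord_recr /= bin_small ?mulr0n ?addr0; last by lia.
rewrite mulr_sumr -sumrN.
apply: eq_bigr => r _; rewrite doubleS !subSS mulrnAr -mulNrn !exprS.
by congr (_ *+ _); ring.
Qed.

Lemma lucas_coef_homo (k k' r : nat) : (k <= k')%N ->
  (lucas_coef k r <= lucas_coef k' r)%N.
Proof.
move=> le_k; apply: leq_add; first by apply: leq_bin2l; rewrite leq_sub2r.
by case: r => // r; apply: leq_bin2l; rewrite leq_sub2r.
Qed.

(** * The height *)

Module HeightRes.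
Import mpoly.

Lemma height_sum_monomials (p : nat) (T : finType) (A : pred T) (c : T -> int)
    (m : T -> 'X_{1..p}) (h : int) :
  {in A &, injective m} -> (forall t, A t -> `|c t| <= h) ->
  (exists2 t, A t & `|c t| = h) ->
  height (\sum_(t | A t) c t *: 'X_[m t]) = h.
Proof.
move=> m_inj le_h [t0 At0 eq_h].
set S := \sum_(t | _) _.
have coefS t : A t -> S@_(m t) = c t.
  move=> At; rewrite /S raddf_sum (bigD1 t) //= mcoeffZ mcoeffX eqxx mulr1.
  rewrite big1 ?addr0 // => u /andP[Au neq_ut]; rewrite mcoeffZ mcoeffX.
  case: eqP => [/m_inj eq_ut|_]; last by rewrite mulr0.
  by rewrite eq_ut ?eqxx // in neq_ut.
have h_ge0 : 0 <= h by rewrite -eq_h normr_ge0.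
apply/le_anti/andP; split.
  apply: bigmax_le => // u _.
  have [/existsP[t /andP[At /eqP <-]]|/existsPn noT] :=
      boolP [exists t, A t && (m t == u)]; first by rewrite coefS ?le_h.
  rewrite /S raddf_sum big1 ?normr0 // => t At; rewrite /= mcoeffZ mcoeffX.
  by have := noT t; rewrite At /= => /negbTE ->; rewrite mulr0.
(* If the extremal coefficient is 0, its monomial is absent from the support and the default value 0
   of the maximum takes over. *)
have [c0|c_neq0] := eqVneq (c t0) 0.
  by rewrite -eq_h c0 normr0; apply: bigmax_ge_id.
rewrite -eq_h -(coefS t0 At0).
apply: (@le_bigmax_seq _ _ _ _ _ (m t0) xpredT (fun u => `|S@_u|)) => //.
by rewrite mcoeff_msupp coefS.
Qed.

Section Res2.
Variable n : nat.

Let T := ('I_n.+1 * 'I_n.+1 * 'I_n.+1)%type.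

Let admissible (t : T) :=
  let: (i, j, r) := t in (i <= j)%N && (r.*2 <= j - i)%N.

Let fvar (k : 'I_3) : 'I_(3 + n.+1) := lshift n.+1 k.
Let gvar (i : 'I_n.+1) : 'I_(3 + n.+1) := rshift 3 i.

Let monomial (t : T) : 'X_{1..3 + n.+1} :=
  let: (i, j, r) := t in
  (U_(gvar i) + U_(gvar j) + U_(fvar 0%R) *+ (i + r)
   + U_(fvar 1%R) *+ (j - i - r.*2) + U_(fvar 2%:R%R) *+ (n - j + r))%MM.

Let coeff (t : T) : int :=
  let: (i, j, r) := t in
  (-1) ^+ (r + (j - i - r.*2)) * (lucas_coef (j - i) r)%:R.

(** The exponents of the g-variables give the multiset {i, j}, hence the pair, as i <= j. The
    exponent j - i - 2r of f_1, untruncated for admissible triples, then gives r. *)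
Lemma monomial_inj : {in admissible &, injective monomial}.
Proof.
move=> [[i j] r] [[i' j'] r']; rewrite !unfold_in /= => /andP[le_ij le_r].
move=> /andP[le_ij' le_r'] /mnmP eq_m.
have eq_g (k : 'I_n.+1) :
    ((i == k) + (j == k) = (i' == k) + (j' == k))%N.
  have := eq_m (gvar k); rewrite !(mnmDE, mulmnE, mnm1E).
  by rewrite !(inj_eq (@rshift_inj _ _)) !eq_lrshift !mul0n !addn0.
have eq_f1 : (j - i - r.*2 = j' - i' - r'.*2)%N.
  have := eq_m (fvar 1); rewrite !(mnmDE, mulmnE, mnm1E).
  rewrite !(inj_eq (@lshift_inj _ _)) !eq_rlshift /= !mul0n !addn0 !add0n.
  by rewrite !mul1n.
have [ei ej] : i = i' /\ j = j'.
  have [ei|ne_i] := eqVneq i i'.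
    split=> //; have := eq_g j; rewrite ei eqxx => /addnI.
    by case: eqP.
  have := eq_g i; rewrite eqxx [i' == i]eq_sym (negbTE ne_i) add0n.
  case: (j' =P i) => [ej'|_]; last by case: (_ == _).
  have := eq_g i'; rewrite eqxx (negbTE ne_i) add0n.
  case: (j =P i') => [ej|_]; last by case: (_ == _).
  case/eqP: ne_i; apply: val_inj; apply/eqP.
  by rewrite eqn_leq -{1}ej le_ij -ej' le_ij'.
rewrite {}ei {}ej in le_r eq_f1 *; congr (_, _, _); apply: val_inj => /=.
move: (nat_of_ord r) (nat_of_ord r') (nat_of_ord i') (nat_of_ord j') le_r le_r'
  eq_f1 => a b c d {eq_g eq_m le_ij le_ij'}; lia.
Qed.

Lemma Res_quadraticE :
  Res 2 n = \sum_(t | admissible t) coeff t *: 'X_[monomial t].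
Proof.
rewrite /Res det_sylvester_quadratic; last first.
  by rewrite -msupp_eq0 msuppX.
under eq_bigr => i _ do under eq_bigr => j _ do
  rewrite (@lucas_polE _ _ _ _ n.+1 (leq_ltn_trans (leq_subr i j) (ltn_ord j)))
    !mulr_sumr.
rewrite pair_big_dep pair_big_dep; apply: eq_big => -[[i j] r] //= _.
rewrite [(- 'X_(lshift n.+1 1)) ^+ _]exprNn exprMn !mpolyXD -!mpolyXn !exprD.
rewrite -mul_mpolyC !rmorphM !rmorphXn rmorphN1 rmorph_nat -mulr_natr /gvar
  /fvar.
by ring.
Qed.

(** By [lucas_coef_homo] the largest coefficients occur at the largest difference j - i, that is at
    i = 0 and j = n, leaving a maximum over r alone. *)
Lemma height_Res_quadratic : exists r : nat,
  [/\ (r.*2 <= n)%N, height (Res 2 n) = lucas_coef n r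
    & forall r', (r'.*2 <= n)%N -> (lucas_coef n r' <= lucas_coef n r)%N].
Proof.
pose lc (r : 'I_n.+1) := lucas_coef n r.
have [r le_r max_r] :=
  @arg_maxnP _ (0 : 'I_n.+1) (fun r => r.*2 <= n)%N lc (leq0n n).
have max_r' r' : (r'.*2 <= n)%N -> (lucas_coef n r' <= lucas_coef n r)%N.
  move=> le_r'; have lt_r' : (r' < n.+1)%N by lia.
  exact: (max_r (Ordinal lt_r')).
exists r; split => //.
have norm_coeff t : `|coeff t| =
    let: (i, j, r) := t in (lucas_coef (j - i) r)%:Z.
  case: t => -[i j] k; rewrite /= normrM normrX normrN1 expr1n mul1r.
  by rewrite normr_nat natz.
rewrite Res_quadraticE; apply: height_sum_monomials.
- exact: monomial_inj.
- move=> [[i j] k] /andP[le_ij le_k]; rewrite norm_coeff lez_nat.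
  have le_jin : (j - i <= n)%N by rewrite (leq_trans (leq_subr _ _)) // -ltnS.
  apply: leq_trans (max_r' k _); first exact: lucas_coef_homo.
  exact: leq_trans le_k le_jin.
- exists (0, ord_max, r); first by rewrite /= subn0.
  by rewrite norm_coeff subn0.
Qed.

End Res2.
End HeightRes.

From mathcomp Require Import all_classical topology normedtype derive realfun.
From mathcomp Require Import sequences exp.

Import numFieldNormedType.Exports.

(** * Wallis' product *)

Section Wallis.
Variable R : realType.
Implicit Types (x : R) (n : nat).

Fixpoint cos_power_primitive n x : R :=
  match n with
  | 0 => x
  | 1 => sin x
  | n'.+2 => n'.+2%:R^-1 * (cos x ^+ n'.+1 * sin x
                            + n'.+1%:R * cos_power_primitive n' x)
  end.

Lemma is_derive_cos_power_primitive n x :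
  is_derive x 1 (cos_power_primitive n) (cos x ^+ n).
Proof.
have [] : is_derive x 1 (cos_power_primitive n) (cos x ^+ n) /\
    is_derive x 1 (cos_power_primitive n.+1) (cos x ^+ n.+1); last by [].
elim: n => [|n [IH1 IH2]].
  split; first exact: is_derive_id.
  by rewrite expr1; exact: is_derive_sin.
split=> //.
have -> : cos_power_primitive n.+2 = n.+2%:R^-1 \*:
    ((fun y => cos y) ^+ n.+1 * (fun y => sin y) +
      n.+1%:R \*: cos_power_primitive n).
  by apply/funext => y /=; rewrite /= !fctE.
apply: is_derive_eq.
rewrite /GRing.scale /= fctE.
have sE : sin x * sin x = 1 - cos x ^+ 2 by rewrite -expr2 -(cos2Dsin2 x); ring.
have -> : sin x * (n.+1%:R * cos x ^+ n * - sin x) =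
    - (n.+1%:R * cos x ^+ n * (sin x * sin x)) by ring.
have -> : n.+2%:R = n.+1%:R + 1 :> R by rewrite -natr1.
rewrite sE !exprS; field.
by rewrite nat1r natr1 pnatr_eq0.
Qed.

Lemma cos_power_primitive0 n : cos_power_primitive n 0 = 0.
Proof.
have [] : cos_power_primitive n 0 = 0 /\ cos_power_primitive n.+1 0 = 0;
  last by [].
elim: n => [|n [IH1 IH2]]; first by rewrite /= sin0.
by split=> //=; rewrite sin0 IH1 !mulr0 addr0 mulr0.
Qed.

Let W n := cos_power_primitive n (pi / 2).

Lemma wallis_rec n : W n.+2 = n.+1%:R / n.+2%:R * W n.
Proof. by rewrite /W /= cos_pihalf exprS !mul0r add0r mulrCA mulrA. Qed.

(** The difference of the two primitives has derivative cos^n - cos^(n+1), nonnegative on [0, pi/2];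
    the mean value theorem concludes. *)
Lemma wallis_homo n : W n.+1 <= W n.
Proof.
have pi2_ge0 : 0 <= pi / 2 :> R by rewrite divr_ge0 ?pi_ge0.
have dW x : is_derive x 1
    (cos_power_primitive n - cos_power_primitive n.+1)
    (cos x ^+ n - cos x ^+ n.+1).
  by apply: is_deriveB; exact: is_derive_cos_power_primitive.
have [|c c_itv] := @MVT_segment R
  (cos_power_primitive n - cos_power_primitive n.+1)
  (fun x => cos x ^+ n - cos x ^+ n.+1) 0 (pi / 2) pi2_ge0
  (fun x _ => dW x).
  by apply: derivable_within_continuous => x _; exact: ex_derive.
rewrite !fctE !cos_power_primitive0 !subr0 => eqW; rewrite -subr_ge0 /W eqW.
have cos_ge0 : 0 <= cos c.
  move: c_itv; rewrite in_itv /= => /andP[c_ge0 c_le]; apply: cos_ge0_pihalf.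
  by rewrite c_le (le_trans _ c_ge0) // oppr_le0.
rewrite mulr_ge0 // exprS -{1}[cos c ^+ n]mul1r -mulrBl mulr_ge0 ?exprn_ge0 //.
by rewrite subr_ge0 cos_le1.
Qed.

Lemma wallis_mul n : W n * W n.+1 = pi / (2 * n.+1%:R).
Proof.
elim: n => [|n IH]; first by rewrite /W /= sin_pihalf !mulr1.
rewrite wallis_rec mulrCA [W n.+1 * _]mulrC IH.
by field; rewrite nat1r -natrD !pnatr_eq0.
Qed.

Lemma wallis_even m :
  W m.*2 * (4 ^+ m * m`!%:R ^+ 2) = pi / 2 * (m.*2)`!%:R.
Proof.
elim: m => [|m IH]; first by rewrite /W /= fact0 expr0 expr1n !mulr1.
rewrite doubleS wallis_rec !factS !natrM.
transitivity (W m.*2 * (4 ^+ m * m`!%:R ^+ 2) * (m.*2.+2%:R * m.*2.+1%:R));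
  last by rewrite IH; ring.
have -> : m.*2.+2%:R = 2 * m.+1%:R :> R by rewrite -doubleS -mul2n natrM.
by rewrite exprS; field; rewrite ?(nat1r, natr1, pnatr_eq0).
Qed.

(** By monotonicity the square of W_(2m) lies between W_(2m) W_(2m+1) and W_(2m-1) W_(2m), both
    known from [wallis_mul]. *)
Lemma wallis_even_bounds m : (0 < m)%N ->
  pi / (2 * m.*2.+1%:R) <= W m.*2 ^+ 2 <= pi / (4 * m%:R).
Proof.
case: m => // m _.
have W_ge0 n : 0 <= W n.
  elim/ltn_ind: n => -[|[|n]] IH; first by rewrite /W divr_ge0 ?pi_ge0.
    by rewrite /W /= sin_pihalf.
  by rewrite wallis_rec mulr_ge0 ?divr_ge0 // IH // ltnS leqnSn.
apply/andP; split; first by rewrite -wallis_mul expr2 ler_wpM2l ?wallis_homo.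
have -> : pi / (4 * m.+1%:R) = W m.*2.+1 * W m.*2.+2 :> R.
  rewrite wallis_mul; congr (_ / _).
  by rewrite -doubleS -mul2n natrM; ring.
by rewrite expr2 ler_wpM2r ?wallis_homo.
Qed.

End Wallis.

(** * Explicit bounds for the logarithm *)

Section LogBounds.
Variable R : realType.
Implicit Types (u t x : R).

Lemma is_derive_ln_affine (c x : R) : 0 < 1 + c * x ->
  is_derive x 1 (fun y => ln (1 + c * y)) (c / (1 + c * x)).
Proof.
move=> gt0.
have da : is_derive x 1 (fun y => 1 + c * y) c.
  rewrite [X in is_derive _ _ X _](_ : _ = cst 1 + c \*: id); last first.
    by apply: funext => y; rewrite /= !fctE.
  by apply: is_derive_eq; rewrite add0r /GRing.scale /= mulr1.
have dl : is_derive (1 + c * x) 1 (@ln R) (1 + c * x)^-1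
  by exact: is_derive1_ln.
rewrite [c / _]mulrC.
exact: (@is_derive1_comp _ (@ln R) (fun y => 1 + c * y) x _ _ dl da).
Qed.

Lemma le_of_ge0_derive (f df : R -> R) (b : R) : 0 <= b ->
  (forall x, 0 <= x <= b -> is_derive x 1 f (df x) /\ 0 <= df x) -> f 0 <= f b.
Proof.
move=> b_ge0 fP.
have [x /andP[x0 xb]||c] := @MVT_segment R f df 0 b b_ge0.
- by have [] := fP x _; rewrite // !ltW.
- apply: derivable_within_continuous => x; rewrite in_itv /= => /fP[dfx _].
  exact: ex_derive.
rewrite in_itv /= => /fP[_ df_ge0]; rewrite subr0 => eq_f.
by rewrite -subr_ge0 eq_f mulr_ge0.
Qed.

(* The choice K = 1 bounds the derivative of ln ((1 + x) / (1 - x)) from below,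
   and K = 1 / (1 - t ^+ 2) from above on [0, t]. *)
Lemma is_derive_ln_ratio (K x : R) : 0 <= x < 1 ->
  is_derive x 1
    (fun y => ln (1 + 1 * y) - ln (1 + (-1) * y) - (2 * y + 2 / 3 * K * y ^+ 3))
    (2 * x ^+ 2 * ((1 - x ^+ 2)^-1 - K)).
Proof.
move=> /andP[x_ge0 x_lt1].
have d1 := @is_derive_ln_affine 1 x.
have d2 := @is_derive_ln_affine (-1) x.
have d3 : is_derive x 1 (fun y : R => 2 * y + 2 / 3 * K * y ^+ 3)
    (2 + 2 * K * x ^+ 2).
  rewrite [X in is_derive _ _ X _](_ : _ = 2 \*: id + (2 / 3 * K) \*: id ^+ 3).
    by apply: is_derive_eq; rewrite /GRing.scale /=; field.
  by apply: funext => y; rewrite /= !fctE.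
have dd := is_deriveB (is_deriveB (d1 _) (d2 _)) d3.
apply: is_derive_eq (dd _ _) _; [lra|lra|].
have ne1 : 1 + x != 0 by rewrite gt_eqF //; lra.
have ne2 : 1 - x != 0 by rewrite gt_eqF //; lra.
have -> : 1 - x ^+ 2 = (1 + x) * (1 - x) by ring.
rewrite mul1r mulN1r; field.
by rewrite ne1 ne2.
Qed.

(** The lower bound is the start of the series of 2 artanh t; the upper one dominates its tail by a
    geometric series. At t = 1/(2m+1) the ratio (1+t)/(1-t) is (m+1)/m. *)
Lemma ln_ratio_bounds t : 0 <= t < 1 ->
  2 * t + 2 / 3 * t ^+ 3 <= ln (1 + t) - ln (1 - t)
    <= 2 * t + 2 / 3 * (t ^+ 3 / (1 - t ^+ 2)).
Proof.
move=> /andP[t_ge0 t_lt1].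
pose f K y : R :=
  ln (1 + 1 * y) - ln (1 + (-1) * y) - (2 * y + 2 / 3 * K * y ^+ 3).
have f0 K : f K 0 = 0 by rewrite /f !mulr0 !addr0 ln1 expr0n mulr0; ring.
have itv x : 0 <= x <= t -> [/\ 0 <= x < 1, 0 < 1 - x ^+ 2 & x ^+ 2 <= t ^+ 2].
  by move=> /andP[x0 xt]; split; nra.
have ft K : f K t = ln (1 + t) - ln (1 - t) - (2 * t + 2 / 3 * K * t ^+ 3).
  by rewrite /f mul1r mulN1r.
have pos_t : 0 < 1 - t ^+ 2 by nra.
have lo : f 1 0 <= f 1 t.
  apply: (@le_of_ge0_derive (f 1)
    (fun x => 2 * x ^+ 2 * ((1 - x ^+ 2)^-1 - 1))) => // x.
  move=> /itv[x_itv pos_x _]; split; first exact: is_derive_ln_ratio.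
  apply: mulr_ge0; first by rewrite mulr_ge0 ?sqr_ge0.
  rewrite subr_ge0 invf_ge1 //.
  by have := sqr_ge0 x; lra.
pose K := (1 - t ^+ 2)^-1.
have up : - f K 0 <= - f K t.
  apply: (@le_of_ge0_derive (- f K)
    (fun x => - (2 * x ^+ 2 * ((1 - x ^+ 2)^-1 - K)))) => // x.
  move=> /itv[x_itv pos_x le_xt]; split.
    by apply: is_deriveN; exact: is_derive_ln_ratio.
  rewrite -mulrN; apply: mulr_ge0; first by rewrite mulr_ge0 ?sqr_ge0.
  rewrite opprB subr_ge0 /K lef_pV2 ?posrE //.
  by lra.
move: lo up; rewrite !f0 !ft /K; set L := ln (1 + t) - ln (1 - t) => lo up.
have -> : 2 / 3 * (t ^+ 3 / (1 - t ^+ 2)) = 2 / 3 * (1 - t ^+ 2)^-1 * t ^+ 3.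
  by rewrite [RHS]mulrAC mulrA.
by apply/andP; split; lra.
Qed.

(** Applying the upper bound to 1/(1+u) gives ln(1+u) >= u/(1+u), and u/(1+u) >= u - 2u^2 as soon as
    u >= -1/2. *)
Lemma ln1D_bounds u : - (1 / 2) <= u -> u - 2 * u ^+ 2 <= ln (1 + u) <= u.
Proof.
move=> u_ge; have pos : 0 < 1 + u by lra.
apply/andP; split; last by apply: le_ln1Dx; lra.
have eqv : (1 + u)^-1 = 1 + - (u / (1 + u)) by field; rewrite gt_eqF.
have : ln (1 + u)^-1 <= - (u / (1 + u)).
  rewrite {1}eqv; apply: le_ln1Dx.
  by rewrite -subr_gt0 opprK addrC -eqv invr_gt0.
rewrite lnV ?posrE // lerN2; apply: le_trans.
by rewrite ler_pdivlMr //; nra.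
Qed.

Lemma le_norm_of_derive (f df : R -> R) (b M : R) :
  (forall x, `|x| <= `|b| -> is_derive x 1 f (df x) /\ `|df x| <= M) ->
  `|f b - f 0| <= M * `|b|.
Proof.
move=> fP.
have [b_ge0|b_lt0] := leP 0 b.
  have itv : {in `[0, b]%R, forall x, `|x| <= `|b|}.
    by move=> x; rewrite in_itv /= => /andP[x0 xb]; rewrite !ger0_norm.
  have [x x_itv||c c_itv] := @MVT_segment R f df 0 b b_ge0.
  - by have [|] := fP x _ => //; apply: itv; apply: subset_itv_oo_cc.
  - apply: derivable_within_continuous => x /itv /fP[dfx _]; exact: ex_derive.
  by rewrite subr0 => ->; rewrite normrM ler_wpM2r ?(fP c _).2 ?itv.
have itv : {in `[b, 0]%R, forall x, `|x| <= `|b|}.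
  move=> x; rewrite in_itv /= => /andP[xb x0].
  by rewrite !ler0_norm ?lerN2 // ltW.
have [x x_itv||c c_itv] := @MVT_segment R f df b 0 (ltW b_lt0).
- by have [|] := fP x _ => //; apply: itv; apply: subset_itv_oo_cc.
- apply: derivable_within_continuous => x /itv /fP[dfx _]; exact: ex_derive.
by rewrite sub0r distrC => ->; rewrite normrM normrN ler_wpM2r ?(fP c _).2 ?itv.
Qed.

(** The function inside the absolute value has derivative ln(1+x) - x, which is at most 2u^2 in
    absolute value for |x| <= |u|. *)
Lemma xlnx_bounds u : `|u| <= 1 / 2 ->
  `|(1 + u) * ln (1 + u) - u - u ^+ 2 / 2| <= 2 * `|u| ^+ 3.
Proof.
move=> u_le.
pose f y : R := (1 + 1 * y) * ln (1 + 1 * y) - (y + 1 / 2 * y ^+ 2).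
have f0 : f 0 = 0 by rewrite /f mulr0 addr0 ln1 expr0n !mulr0; ring.
have -> : (1 + u) * ln (1 + u) - u - u ^+ 2 / 2 = f u - f 0.
  by rewrite f0 /f mul1r; field.
rewrite exprS mulrCA [_ * (2 * _)]mulrC.
apply: (@le_norm_of_derive f (fun x => ln (1 + x) - x)) => x le_xu.
have /andP[x_ge x_le] : - (1 / 2) <= x <= 1 / 2
  by rewrite -ler_norml (le_trans le_xu).
split; last first.
  have /andP[lo hi] := ln1D_bounds _ x_ge.
  have le_sq : x ^+ 2 <= `|u| ^+ 2 by rewrite -real_normK ?num_real //
    lerXn2r ?nnegrE.
  by rewrite ler_norml; apply/andP; split; have := sqr_ge0 x; lra.
have pos : 0 < 1 + 1 * x by lra.
have dl := @is_derive_ln_affine 1 x pos.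
have da : is_derive x 1 (fun y : R => 1 + 1 * y) 1.
  rewrite [X in is_derive _ _ X _](_ : _ = cst 1 + 1 \*: id); last first.
    by apply/funext => y; rewrite /= !fctE.
  by apply: is_derive_eq; rewrite add0r /GRing.scale /= mulr1.
have dp : is_derive x 1 (fun y : R => y + 1 / 2 * y ^+ 2) (1 + x).
  rewrite [X in is_derive _ _ X _](_ : _ = id + (1 / 2) \*: id ^+ 2).
    by apply: is_derive_eq; rewrite /GRing.scale /=; field.
  by apply: funext => y; rewrite /= !fctE.
have dd := is_deriveB (is_deriveM da dl) dp.
apply: is_derive_eq dd _; rewrite /GRing.scale /= !mul1r; field.
by rewrite gt_eqF //; lra.
Qed.
End LogBounds.

(** * Stirling's formula *)

Section Stirling.
Variable R : realType.
Implicit Types m : nat.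

(** This is the logarithm of m! e^m / m^(m+1/2), whose limit is ln(2 pi)/2. *)
Definition stirling_rem m : R :=
  ln m`!%:R - (m%:R + 1 / 2) * ln m%:R + m%:R.

Let s := stirling_rem.

(** Robbins' argument: with t = 1/(2m+1) the difference is ln((1+t)/(1-t))/(2t) - 1, which lies
    between t^2/3 and t^2/(3(1-t^2)). The latter equals 1/(12m) - 1/(12(m+1)). *)
Lemma stirling_rem_step m : (0 < m)%N ->
  (12 * m%:R + 1)^-1 - (12 * m.+1%:R + 1)^-1 <= s m - s m.+1
    <= (12 * m%:R)^-1 - (12 * m.+1%:R)^-1.
Proof.
move=> m_gt0.
have x_ge1 : 1 <= m%:R :> R by rewrite ler1n.
rewrite /s /stirling_rem factS natrM.
have -> : m.+1%:R = m%:R + 1 :> R by rewrite natr1.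
have fact_gt0 : 0 < m`!%:R :> R by rewrite ltr0n fact_gt0.
rewrite lnM ?posrE //; last by lra.
move: fact_gt0 x_ge1; set x : R := m%:R; set F : R := m`!%:R => F_gt0 x_ge1.
pose t := (2 * x + 1)^-1.
have tE : t * (2 * x + 1) = 1 by rewrite mulVf // gt_eqF //; lra.
have t_itv : 0 <= t < 1.
  by rewrite invr_ge0 invf_lt1; [apply/andP; split; lra|lra].
have /andP[t_ge0 t_lt1] := t_itv.
have /andP[lo hi] := ln_ratio_bounds R t t_itv.
have ratio : ln (1 + t) - ln (1 - t) = ln (x + 1) - ln x.
  rewrite -!ln_div ?posrE; [|lra..].
  congr ln; rewrite /t; field.
  by rewrite !gt_eqF //; lra.
rewrite ratio in lo hi.
set L := ln (x + 1) - ln x in lo hi.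
have -> : ln F - (x + 1 / 2) * ln x + x -
    (ln (x + 1) + ln F - (x + 1 + 1 / 2) * ln (x + 1) + (x + 1)) =
    (x + 1 / 2) * L - 1 by rewrite /L; ring.
have two_x : x + 1 / 2 = (2 * t)^-1.
  by rewrite /t invfM invrK; field.
have t_gt0 : 0 < t by rewrite invr_gt0; lra.
have lo' : 1 + t ^+ 2 / 3 <= (x + 1 / 2) * L.
  rewrite two_x [_^-1 * L]mulrC ler_pdivlMr ?mulr_gt0 //; apply: le_trans lo.
  by rewrite le_eqVlt; apply/orP; left; apply/eqP; field.
have hi' : (x + 1 / 2) * L <= 1 + t ^+ 2 / (1 - t ^+ 2) / 3.
  rewrite two_x [_^-1 * L]mulrC ler_pdivrMr ?mulr_gt0 //; apply: le_trans hi _.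
  rewrite le_eqVlt; apply/orP; left; apply/eqP; field.
  by rewrite gt_eqF //; nra.
have tsq : t ^+ 2 = (2 * x + 1) ^- 2 by rewrite exprVn.
apply/andP; split.
  rewrite lerBrDr addrC; apply: le_trans lo'; rewrite lerD2l tsq.
  have -> : (12 * x + 1)^-1 - (12 * (x + 1) + 1)^-1 =
      12 / ((12 * x + 1) * (12 * (x + 1) + 1)).
    by field; rewrite !gt_eqF //; lra.
  have -> : (2 * x + 1) ^- 2 / 3 = 12 / (36 * (2 * x + 1) ^+ 2).
    by field; rewrite !gt_eqF //; lra.
  (* The two denominators differ by 24x - 23, positive since x >= 1. *)
  rewrite ler_wpM2l // lef_pV2 ?posrE; nra.
rewrite lerBlDr [leRHS]addrC; apply: le_trans hi' _; rewrite lerD2l tsq.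
rewrite le_eqVlt; apply/orP; left; apply/eqP; field.
rewrite !gt_eqF //=; nra.
Qed.

Lemma telescope_le (f g : nat -> R) m k : (0 < m <= k)%N ->
  (forall i, (0 < i)%N -> f i - f i.+1 <= g i - g i.+1) ->
  f m - f k <= g m - g k.
Proof.
move=> /andP[m_gt0 /subnK <-] fg.
elim: (k - m)%N => [|j IH]; first by rewrite !subrr.
have := fg (j + m)%N; rewrite addn_gt0 m_gt0 orbT => /(_ isT).
by rewrite addSn; lra.
Qed.

Lemma eq0_norm_le_inv (a C : R) :
  (forall m, (0 < m)%N -> `|a| <= C / m%:R) -> a = 0.
Proof.
move=> le_a; apply/eqP; apply: contraT; rewrite -normr_gt0 => a_gt0.
have C_ge0 : 0 <= C by have := le_a 1%N isT; rewrite divr1; apply: le_trans.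
have q_ge0 : 0 <= C / `|a| by rewrite divr_ge0.
have := archi_boundP q_ge0; set m := Num.bound _.
rewrite ltr_pdivrMr // => lt_C.
have m_gt0 : (0 < m)%N.
  by rewrite lt0n; apply: contraTneq lt_C => ->; rewrite mul0r -leNgt.
have := le_a _ m_gt0; rewrite ler_pdivlMr ?ltr0n // mulrC.
by rewrite leNgt lt_C.
Qed.

(** By telescoping, s m - 1/(12m) increases and s m - 1/(12m+1) decreases; the supremum of the
    former separates the two sequences. *)
Lemma stirling_rem_lim : {c | forall m, (0 < m)%N ->
  (12 * m%:R + 1)^-1 <= s m - c <= (12 * m%:R)^-1}.
Proof.
pose u m := s m - (12 * m%:R)^-1.
pose v m := s m - (12 * m%:R + 1)^-1.
have u_incr m k : (0 < m <= k)%N -> u m <= u k.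
  move=> mk; have := telescope_le s (fun m => (12 * m%:R)^-1) m k mk _.
  rewrite /u; have H i : (0 < i)%N ->
      s i - s i.+1 <= (12 * i%:R)^-1 - (12 * i.+1%:R)^-1.
    by move=> /stirling_rem_step /andP[].
  by move=> /(_ H); lra.
have v_decr m k : (0 < m <= k)%N -> v k <= v m.
  move=> mk; have := telescope_le (fun m => (12 * m%:R + 1)^-1) s m k mk _.
  rewrite /v; have H i : (0 < i)%N ->
      (12 * i%:R + 1)^-1 - (12 * i.+1%:R + 1)^-1 <= s i - s i.+1.
    by move=> /stirling_rem_step /andP[].
  by move=> /(_ H); lra.
have u_le_v m k : (0 < m)%N -> (0 < k)%N -> u m <= v k.
  move=> m_gt0 k_gt0; have [mk|/ltnW km] := leqP m k.
    apply: le_trans (u_incr m k _) _; first by rewrite m_gt0 mk.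
    rewrite /u /v lerB // lef_pV2 ?posrE ?addr_gt0 ?mulr_gt0 ?ltr0n //.
    by rewrite lerDl.
  apply: le_trans _ (v_decr k m _); last by rewrite k_gt0 km.
  rewrite /u /v lerB // lef_pV2 ?posrE ?addr_gt0 ?mulr_gt0 ?ltr0n //.
  by rewrite lerDl.
pose E : set R := fun x => exists2 m, (0 < m)%N & x = u m.
exists (sup E) => m m_gt0.
have ubE k : (0 < k)%N -> ubound E (v k).
  by move=> k_gt0 _ [j j_gt0 ->]; exact: u_le_v.
have le1 : u m <= sup E.
  by apply: ub_le_sup; [exists (v 1%N); exact: ubE | exists m].
have le2 : sup E <= v m.
  by apply: ge_sup; [exists (u m); exists m | exact: ubE].
by move: le1 le2; rewrite /u /v => le1 le2; apply/andP; split; lra.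
Qed.

(** The combination 2 s(k) - s(2k) tends to the unknown limit c, while Wallis' product evaluates it
    as ln(2 pi)/2 + O(1/k). Hence |c - ln(2 pi)/2| <= 1/k for every k > 0. *)
Lemma stirling_bounds m : (0 < m)%N ->
  (12 * m%:R + 1)^-1 <= s m - ln (2 * pi) / 2 <= (12 * m%:R)^-1.
Proof.
have [c cP] := stirling_rem_lim; suff <- : c = ln (2 * pi) / 2 by exact: cP.
apply/eqP; rewrite -subr_eq0; apply/eqP.
apply: (eq0_norm_le_inv _ 1) => k k_gt0.
have k_ge1 : 1 <= k%:R :> R by rewrite ler1n.
have pi_pos := pi_gt0 R.
have k_pos : 0 < k%:R :> R by rewrite ltr0n.
have kk : k.*2%:R = 2 * k%:R :> R by rewrite -mul2n natrM.
have /andP[W_lo W_hi] := wallis_even_bounds R k k_gt0.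
set W := cos_power_primitive R k.*2 (pi / 2) in W_lo W_hi.
have WE := wallis_even R k; rewrite -/W in WE.
have F_gt0 j : 0 < j`!%:R :> R by rewrite ltr0n fact_gt0.
have W_gt0 : 0 < W.
  rewrite -(pmulr_lgt0 _ (_ : 0 < 4 ^+ k * k`!%:R ^+ 2)); last first.
    by rewrite mulr_gt0 ?exprn_gt0.
  by rewrite WE mulr_gt0 // divr_gt0.
have ln4 : ln 4 = 2 * ln 2 :> R.
  have -> : 4 = 2 ^+ 2 :> R by ring.
  by rewrite lnXn //; ring.
have lnWE : ln W + (k%:R * (2 * ln 2) + 2 * ln k`!%:R) =
    ln pi - ln 2 + ln k.*2`!%:R.
  have <- : ln (pi / 2) = ln pi - ln 2 :> R by rewrite ln_div ?posrE.
  rewrite -lnM ?posrE ?divr_gt0 // -WE lnM ?posrE ?mulr_gt0 ?exprn_gt0 //.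
  rewrite lnM ?posrE ?exprn_gt0 // !lnXn // ln4; ring.
have W2 : ln (W ^+ 2) = 2 * ln W by rewrite lnXn //; ring.
have hi : 2 * ln W <= ln pi - 2 * ln 2 - ln k%:R.
  rewrite -W2; apply: le_trans (_ : ln (pi / (4 * k%:R)) <= _).
    by rewrite ler_ln ?posrE ?exprn_gt0 ?divr_gt0 ?mulr_gt0.
  by rewrite ln_div ?posrE ?mulr_gt0 // lnM ?posrE // ln4; lra.
have lo : ln pi - ln 2 - ln 2 - ln k%:R - (2 * k%:R)^-1 <= 2 * ln W.
  rewrite -W2; apply: (@le_trans _ _ (ln (pi / (2 * k.*2.+1%:R)))); last first.
    by rewrite ler_ln ?posrE ?exprn_gt0 ?divr_gt0 ?mulr_gt0 ?ltr0n.
  rewrite ln_div ?posrE ?mulr_gt0 ?ltr0n // lnM ?posrE ?ltr0n //.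
  have -> : k.*2.+1%:R = 2 * k%:R * (1 + (2 * k%:R)^-1) :> R.
    by rewrite -addn1 natrD kk; field; rewrite gt_eqF.
  have inv_pos : 0 < (2 * k%:R)^-1 :> R by rewrite invr_gt0 mulr_gt0.
  rewrite lnM ?posrE ?mulr_gt0 ?addr_gt0 // lnM ?posrE //.
  have := @le_ln1Dx R (2 * k%:R)^-1; lra.
have /andP[lo1 hi1] := cP _ k_gt0.
have k2_gt0 : (0 < k.*2)%N by rewrite double_gt0.
have /andP[lo2 hi2] := cP _ k2_gt0.
have e1 : (12 * k%:R)^-1 = 1 / 12 * k%:R^-1 :> R by rewrite invfM; field;
  rewrite gt_eqF.
have e2 : (2 * k%:R)^-1 = 1 / 2 * k%:R^-1 :> R by rewrite invfM; field;
  rewrite gt_eqF.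
have e3 : (12 * k.*2%:R)^-1 = 1 / 24 * k%:R^-1 :> R by rewrite kk; field;
  rewrite gt_eqF.
have p1 : 0 < (12 * k%:R + 1)^-1 :> R by rewrite invr_gt0; lra.
have p2 : 0 < (12 * k.*2%:R + 1)^-1 :> R by rewrite invr_gt0 kk; lra.
have p3 : 0 < k%:R^-1 :> R by rewrite invr_gt0.
have key : 2 * s k - s k.*2 =
    ln pi - ln 2 - ln W + 1 / 2 * ln 2 - 1 / 2 * ln k%:R.
  rewrite /s /stirling_rem kk lnM ?posrE //.
  have -> : ln W =
      ln pi - ln 2 + ln k.*2`!%:R - (k%:R * (2 * ln 2) + 2 * ln k`!%:R).
    by lra.
  by ring.
rewrite lnM ?posrE // div1r ler_norml; apply/andP; split; lra.
Qed.

End Stirling.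

(** * Stirling's formula at a bounded distance from a real point *)

Section StirlingShift.
Variable R : realType.
Implicit Types (X B y : R) (m : nat).

Lemma shift_ratio X B y m : 0 < B -> 2 * B <= X -> m%:R = X + y -> `|y| <= B ->
  [/\ 0 < X, X / 2 <= m%:R, m%:R = X * (1 + y / X),
    `|y / X| <= B / X & `|y / X| <= 1 / 2].
Proof.
move=> B_gt0 le_BX mE le_yB.
have X_gt0 : 0 < X by lra.
have u_le : `|y / X| <= B / X.
  by rewrite normrM normfV (gtr0_norm X_gt0) ler_pM2r ?invr_gt0.
split=> //.
- by move: le_yB; rewrite ler_norml => /andP[lo hi]; lra.
- by rewrite mE; field; rewrite gt_eqF.
- by apply: le_trans u_le _; rewrite ler_pdivrMr //; lra.
Qed.

Lemma ln_shift X B y m : 0 < B -> 2 * B <= X -> m%:R = X + y -> `|y| <= B ->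
  `|ln m%:R - (ln X + y / X)| <= 2 * B ^+ 2 / X ^+ 2.
Proof.
move=> B_gt0 le_BX mE0 le_yB.
have [] := shift_ratio X B y m B_gt0 le_BX mE0 le_yB; set u := y / X.
move=> X_gt0 m_ge mE u_le u_half.
have /andP[u_ge _] : - (1 / 2) <= u <= 1 / 2 by rewrite -ler_norml.
rewrite mE lnM ?posrE; [|lra..].
have /andP[lo hi] := ln1D_bounds R u u_ge.
have sq_le : u ^+ 2 <= B ^+ 2 / X ^+ 2.
  rewrite -expr_div_n -real_normK ?num_real // lerXn2r ?nnegrE //.
  by rewrite divr_ge0 // ltW.
rewrite ler_norml; apply/andP; split; lra.
Qed.

(* The 1/X term is half the second Bernoulli polynomial at y + 1. *)
Lemma stirling_shift X B y m :
  1 <= B -> 2 * B <= X -> m%:R = X + y -> `|y| <= B ->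
  `|ln m`!%:R - ((m%:R + 1 / 2) * ln X - X + ln (2 * pi) / 2
                 + (y ^+ 2 / 2 + y / 2 + 1 / 12) / X)|
    <= (2 * B ^+ 3 + B ^+ 2 + B + 1) / X ^+ 2.
Proof.
move=> B_ge1 le_BX mE0 le_yB.
have B_gt0 : 0 < B by lra.
have [] := shift_ratio X B y m B_gt0 le_BX mE0 le_yB; set u := y / X.
move=> X_gt0 m_ge mE u_le u_half.
have /andP[u_ge u_le'] : - (1 / 2) <= u <= 1 / 2 by rewrite -ler_norml.
have m_gt0 : (0 < m)%N by rewrite -(ltr0n R); lra.
have M_gt0 : 0 < m%:R :> R by rewrite ltr0n.
have /andP[lo hi] := ln1D_bounds R u u_ge.
have g_le := xlnx_bounds R u u_half.
have /andP[slo shi] := stirling_bounds R m m_gt0.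
have lnm : ln m%:R = ln X + ln (1 + u) by rewrite mE lnM ?posrE //; lra.
have yE : y = X * u by rewrite /u; field; rewrite gt_eqF.
pose Z := X^-1.
have Z_gt0 : 0 < Z by rewrite invr_gt0.
have XZ : X * Z = 1 by rewrite mulfV // gt_eqF.
have uZ : `|u| <= B * Z by [].
have u2 : u ^+ 2 <= B ^+ 2 * Z ^+ 2.
  by rewrite -exprMn -real_normK ?num_real // lerXn2r ?nnegrE // mulr_ge0 //
    ltW.
have u3 : `|u| ^+ 3 <= B ^+ 3 * Z ^+ 3.
  by rewrite -exprMn lerXn2r ?nnegrE // mulr_ge0 // ltW.
have e1 : X * `|(1 + u) * ln (1 + u) - u - u ^+ 2 / 2| <= 2 * B ^+ 3 * Z ^+ 2.
  have -> : 2 * B ^+ 3 * Z ^+ 2 = X * (2 * (B ^+ 3 * Z ^+ 3)).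
    by rewrite -[LHS]mulr1 -XZ; ring.
  by rewrite ler_pM2l //; lra.
have e3 : `|stirling_rem R m - ln (2 * pi) / 2 - Z / 12| <= (B + 1) * Z ^+ 2.
  have m_inv : (m%:R)^-1 <= 2 * Z.
    by rewrite -[2]invrK -invfM lef_pV2 ?posrE //; lra.
  have m_inv_gt0 : 0 < (m%:R)^-1 :> R by rewrite invr_gt0.
  pose w : R := (m%:R)^-1.
  have mw : m%:R * w = 1 by rewrite mulfV // gt_eqF.
  have d1 : `|w - Z| <= 2 * B * Z ^+ 2.
    have -> : w - Z = - (y * (w * Z)).
      have -> : y = m%:R - X by rewrite mE0; ring.
      have -> : (m%:R - X) * (w * Z) = (m%:R * w) * Z - (X * Z) * w by ring.
      by rewrite mw XZ; ring.
    rewrite normrN normrM (_ : `|w * Z| = w * Z); last first.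
      by rewrite ger0_norm // mulr_ge0 // ltW.
    have -> : 2 * B * Z ^+ 2 = B * (2 * Z * Z) by ring.
    by apply: ler_pM => //; [rewrite mulr_ge0 // ltW | rewrite ler_pM2r].
  have d2 : w / 12 - Z ^+ 2 / 36 <= (12 * m%:R + 1)^-1.
    apply: (@le_trans _ _ (w / 12 - w ^+ 2 / 144)).
      rewrite lerB // .
      have : w ^+ 2 <= (2 * Z) ^+ 2 by rewrite lerXn2r ?nnegrE // ltW //
        mulr_gt0.
      by rewrite exprMn; lra.
    rewrite -[leRHS]mul1r ler_pdivlMr; last by lra.
    have -> : (w / 12 - w ^+ 2 / 144) * (12 * m%:R + 1) =
      (m%:R * w) - (m%:R * w) * w / 12 + w / 12 - w ^+ 2 / 144 by field.
    by rewrite mw; have := sqr_ge0 w; lra.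
  have d3 : (12 * m%:R)^-1 = w / 12 by rewrite invfM mulrC.
  move: d1; rewrite ler_norml => /andP[d1a d1b].
  have Z2 := sqr_ge0 Z.
  rewrite ler_norml; apply/andP; split; nra.
have -> : ln m`!%:R = stirling_rem R m + (m%:R + 1 / 2) * ln m%:R - m%:R.
  by rewrite /stirling_rem; ring.
have -> : (2 * B ^+ 3 + B ^+ 2 + B + 1) / X ^+ 2 =
    2 * B ^+ 3 * Z ^+ 2 + B ^+ 2 * Z ^+ 2 + (B + 1) * Z ^+ 2.
  by rewrite -exprVn -/Z; ring.
(* The error splits into three parts, bounded by the terms 2B^3, B^2 and B + 1 of the numerator:
   second-order expansion of (1+u) ln(1+u), first-order expansion of ln(1+u), and the Stirling
   remainder. *)
have -> : stirling_rem R m + (m%:R + 1 / 2) * ln m%:R - m%:R -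
  ((m%:R + 1 / 2) * ln X - X + ln (2 * pi) / 2
   + (y ^+ 2 / 2 + y / 2 + 1 / 12) / X)
  = X * ((1 + u) * ln (1 + u) - u - u ^+ 2 / 2) + (ln (1 + u) - u) / 2
    + (stirling_rem R m - ln (2 * pi) / 2 - Z / 12).
  rewrite lnm -/Z.
  have -> : (y ^+ 2 / 2 + y / 2 + 1 / 12) * Z = u ^+ 2 / 2 * X + u / 2 + Z / 12.
    have -> : (y ^+ 2 / 2 + y / 2 + 1 / 12) * Z =
        u ^+ 2 / 2 * X * (X * Z) + u / 2 * (X * Z) + Z / 12
      by rewrite yE; field.
    by rewrite XZ; ring.
  by rewrite mE; field.
apply: le_trans (ler_normD _ _) _; apply: lerD e3.
apply: le_trans (ler_normD _ _) _; apply: lerD.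
  by rewrite normrM (gtr0_norm X_gt0).
by rewrite ler_norml; apply/andP; split; lra.
Qed.
End StirlingShift.

(** * The Lucas triangle *)

(** The identity r C(n-r, r) = (n-r) C(n-r-1, r-1) merges the two binomials into n/(n-r) C(n-r,
    r). *)
Lemma lucas_coef_fact n r : (r.*2 <= n)%N ->
  (lucas_coef n r * (n - r) * (r`! * (n - r.*2)`!) = n * (n - r)`!)%N.
Proof.
move=> le_rn.
have binE : ('C(n - r, r) * (r`! * (n - r.*2)`!) = (n - r)`!)%N.
  by rewrite -[in RHS](@bin_fact (n - r) r) -?subnDA ?addnn //; lia.
suff -> : (lucas_coef n r * (n - r) = n * 'C(n - r, r))%N
  by rewrite -mulnA binE.
rewrite /lucas_coef; case: r le_rn {binE} => [|r] le_rn.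
  by rewrite addn0 subn0 mulnC.
have := mul_bin_diag (n - r.+1) r.
have -> : ((n - r.+1).-1 = n - r.+2)%N by lia.
move=> eq_bin; rewrite mulnDl [('C(_, r) * _)%N]mulnC eq_bin mulnC -mulnDl.
by congr (_ * _)%N; lia.
Qed.

Lemma lucas_coef_gt0 n r : (r.*2 <= n)%N -> (0 < lucas_coef n r)%N.
Proof. by move=> le_rn; rewrite /lucas_coef addn_gt0 bin_gt0; lia. Qed.

Lemma lucas_coef_step n r : (r.*2.+2 <= n)%N ->
  (lucas_coef n r.+1 * (r.+1 * (n - r.+1)) =
   lucas_coef n r * ((n - r.*2) * (n - r.*2).-1))%N.
Proof.
move=> le_rn.
have [k ek] : exists k, n = (r.*2.+2 + k)%N by exists (n - r.*2.+2)%N; lia.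
have E1 := @lucas_coef_fact n r.+1; rewrite doubleS in E1.
have {}E1 := E1 le_rn.
have E0 := @lucas_coef_fact n r (ltnW (ltnW le_rn)).
have e1 : (n - r.*2.+2 = k)%N by lia.
have e2 : (n - r.*2 = k.+2)%N by lia.
have e3 : (n - r = (n - r.+1).+1)%N by lia.
rewrite e1 in E1; rewrite e2 e3 !factS in E0; rewrite e2 /=.
rewrite factS in E1.
have p1 := fact_gt0 r; have p2 := fact_gt0 k.
have p3 : (0 < (n - r.+1).+1)%N by [].
apply/eqP; rewrite -(eqn_pmul2r p3) -(eqn_pmul2r p2) -(eqn_pmul2r p1);
  apply/eqP.
transitivity (lucas_coef n r.+1 * (n - r.+1) * (r.+1 * r`! * k`!)
              * (n - r.+1).+1)%N;
  first by ring.
rewrite E1.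
transitivity (lucas_coef n r * (n - r.+1).+1 * (r`! * (k.+2 * (k.+1 * k`!))))%N;
  last by ring.
by rewrite E0; ring.
Qed.

(* Comparison with the neighbours places a maximiser within O(1) of
   n (1 - 1 / sqrt 5) / 2. *)
Lemma lucas_coef_argmax n r : (r.*2 <= n)%N ->
  (forall r', (r'.*2 <= n)%N -> (lucas_coef n r' <= lucas_coef n r)%N) ->
  ((n - r.*2) * (n - r.*2).-1 <= r.+1 * (n - r.+1))%N /\
  (r * (n - r) <= (n - r.*2).+2 * (n - r.*2).+1)%N.
Proof.
move=> le_rn max_r; split.
  have [le_r1|lt_r1] := leqP r.*2.+2 n; last first.
    have [->//|->//] : (n - r.*2 = 0 \/ n - r.*2 = 1)%N by lia.
  rewrite -(leq_pmul2l (lucas_coef_gt0 n r le_rn)) -lucas_coef_step //.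
  by rewrite leq_mul2r max_r ?orbT // doubleS.
case: r le_rn max_r => [|r] le_rn max_r; first by rewrite mul0n.
have le_rn' : (r.*2 <= n)%N by lia.
rewrite -(leq_pmul2l (lucas_coef_gt0 n r le_rn')).
have e : ((n - r.+1.*2).+2 = n - r.*2)%N by lia.
have := lucas_coef_step n r; rewrite -e /= => <-; last by rewrite -doubleS.
by rewrite leq_mul2r max_r ?orbT.
Qed.

Lemma inv_sqrt5_bounds (R : realFieldType) (k : R) :
  0 < k -> k ^+ 2 = 1 / 5 -> 44 / 100 <= k <= 46 / 100.
Proof.
move=> k_gt0 k_sq; apply/andP; split.
  rewrite leNgt; apply/negP => lt_k.
  have := mulr_gt0 k_gt0 (_ : 0 < 44 / 100 - k); rewrite subr_gt0 => /(_ lt_k).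
  by rewrite mulrBr -expr2 k_sq; lra.
by have := sqr_ge0 (k - 46 / 100); rewrite sqrrB k_sq; lra.
Qed.

(** * Asymptotic expansion near the maximum *)

Section LucasAsymptotics.
Variable R : realType.

Lemma ln_lucas_coef n r : (0 < n)%N -> (r.*2 <= n)%N ->
  ln (lucas_coef n r)%:R =
  ln n%:R - ln (n - r)%:R + ln (n - r)`!%:R - ln r`!%:R
  - ln (n - r.*2)`!%:R :> R.
Proof.
move=> n_gt0 le_rn.
have nr_gt0 : (0 < n - r)%N by lia.
have L_gt0 := lucas_coef_gt0 n r le_rn.
have := congr1 (fun m : nat => ln (m%:R : R)) (lucas_coef_fact n r le_rn).
rewrite !natrM !lnM ?posrE ?mulr_gt0 ?ltr0n ?fact_gt0 //.
by lra.
Qed.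

(** Here k = 1/sqrt 5 and a is the golden ratio. Put mu = (1-k)/2 = k/a and nu = (1+k)/2 = k a; then
    r, n - r and n - 2r are close to mu n, nu n and k n. The terms in x of order 1 cancel because mu
    nu = k^2. *)
Lemma ln_lucas_coef_expansion (k a x : R) (n r : nat) :
  0 < k -> k ^+ 2 = 1 / 5 -> 0 < a -> k * a = (1 + k) / 2 ->
  100 <= n%:R :> R -> (r.*2 <= n)%N ->
  r%:R = (1 - k) / 2 * n%:R + x -> `|x| <= 4 ->
  `|ln (lucas_coef n r)%:R
    - (n%:R * ln a - ln n%:R / 2 - 3 / 2 * ln k - ln (2 * pi) / 2)
    + 5 / 2 * k * (5 * x ^+ 2 - x + 1 / 3) / n%:R| <= 300 * 100 / n%:R ^+ 2.
Proof.
move=> k_gt0 k_sq a_gt0 ka n_ge le_rn rE x_le.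
have /andP[k_lo k_hi] := inv_sqrt5_bounds R k k_gt0 k_sq.
have /andP[x_lo x_hi] : - 4 <= x <= 4 by rewrite -ler_norml.
have n_gt0 : (0 < n)%N by rewrite -(ltr0n R); lra.
rewrite ln_lucas_coef //.
have le_rn1 : (r <= n)%N by lia.
have NE : (n - r)%:R = (1 + k) / 2 * n%:R + - x by rewrite natrB // rE; field.
have ME : (n - r.*2)%:R = k * n%:R + - (2 * x).
  by rewrite natrB // -mul2n natrM rE; field.
set N : R := n%:R in n_ge rE NE ME *.
have N_gt0 : 0 < N by lra.
have mu_a : (1 - k) / 2 * a = k.
  have -> : (1 - k) / 2 * a = (a - k * a) / 2 by field.
  have {1}-> : a = 5 * k * (k * a).
    have e5 : 5 * k ^+ 2 = 1 by rewrite k_sq; field.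
    transitivity (5 * k ^+ 2 * a); last by ring.
    by rewrite e5 mul1r.
  rewrite ka.
  have -> : 5 * k * ((1 + k) / 2) = 5 * k / 2 + 5 / 2 * k ^+ 2 by field.
  by rewrite k_sq; field.
have mu_gt0 : 0 < (1 - k) / 2 by lra.
have nu_gt0 : 0 < (1 + k) / 2 by lra.
have ln_nu : ln ((1 + k) / 2 * N) = ln k + ln a + ln N.
  by rewrite -ka !lnM ?posrE ?mulr_gt0.
have ln_mu : ln ((1 - k) / 2 * N) = ln k - ln a + ln N.
  rewrite lnM ?posrE //; have := congr1 (@ln R) mu_a; rewrite lnM ?posrE //.
  by lra.
have ln_ka : ln (k * N) = ln k + ln N by rewrite lnM ?posrE.
pose Z := N^-1.
have Z_gt0 : 0 < Z by rewrite invr_gt0.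
have inv_nu : ((1 + k) / 2 * N)^-1 = 5 / 2 * (1 - k) * Z.
  rewrite invfM -/Z; congr (_ * _).
  apply: (mulfI (lt0r_neq0 nu_gt0)); rewrite divff ?gt_eqF //.
  have -> : (1 + k) / 2 * (5 / 2 * (1 - k)) = 5 / 4 * (1 - k ^+ 2) by field.
  by rewrite k_sq; field.
have inv_mu : ((1 - k) / 2 * N)^-1 = 5 / 2 * (1 + k) * Z.
  rewrite invfM -/Z; congr (_ * _).
  apply: (mulfI (lt0r_neq0 mu_gt0)); rewrite divff ?gt_eqF //.
  have -> : (1 - k) / 2 * (5 / 2 * (1 + k)) = 5 / 4 * (1 - k ^+ 2) by field.
  by rewrite k_sq; field.
have inv_ka : (k * N)^-1 = 5 * k * Z.
  rewrite invfM -/Z; congr (_ * _).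
  apply: (mulfI (lt0r_neq0 k_gt0)); rewrite divff ?gt_eqF //.
  have -> : k * (5 * k) = 5 * k ^+ 2 by ring.
  by rewrite k_sq; field.
have Z2 := sqr_ge0 Z.
(* The deviations are -x, x and -2x, so |x| <= 4 allows B = 8 in every expansion. *)
have n_nu : 2 * 8 <= (1 + k) / 2 * N by nra.
have n_mu : 2 * 8 <= (1 - k) / 2 * N by nra.
have n_ka : 2 * 8 <= k * N by nra.
have mx : `|- x| <= 8 by rewrite ler_norml; apply/andP; split; lra.
have mx0 : `|x| <= 8 by rewrite ler_norml; apply/andP; split; lra.
have mx2 : `|- (2 * x)| <= 8 by rewrite ler_norml; apply/andP; split; lra.
have b1 := ln_shift R _ 8 _ _ (ltr0n _ _) n_nu NE mx.
have b2 := stirling_shift R _ 8 _ _ (ler1n _ _) n_nu NE mx.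
have b3 := stirling_shift R _ 8 _ _ (ler1n _ _) n_mu rE mx0.
have b4 := stirling_shift R _ 8 _ _ (ler1n _ _) n_ka ME mx2.
move: b1 b2 b3 b4; rewrite -!exprVn inv_nu inv_mu inv_ka ln_nu ln_mu ln_ka.
rewrite NE rE ME -/Z.
(* For B = 8 the error constants are 128 and 1097; the total 128 * 2 + 1097 * (2 + 14 + 5) = 23293
   is below 30000. *)
have sq_nu : (5 / 2 * (1 - k) * Z) ^+ 2 <= 2 * Z ^+ 2.
  rewrite exprMn ler_wpM2r //.
  have -> : (5 / 2 * (1 - k)) ^+ 2 = 25 / 4 * (1 - 2 * k + k ^+ 2) by field.
  by rewrite k_sq; lra.
have sq_mu : (5 / 2 * (1 + k) * Z) ^+ 2 <= 14 * Z ^+ 2.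
  rewrite exprMn ler_wpM2r //.
  have -> : (5 / 2 * (1 + k)) ^+ 2 = 25 / 4 * (1 + 2 * k + k ^+ 2) by field.
  by rewrite k_sq; lra.
have sq_ka : (5 * k * Z) ^+ 2 <= 5 * Z ^+ 2.
  rewrite exprMn ler_wpM2r // exprMn k_sq; lra.
set e1 := ln _ - (_ + _); set e2 := ln _ - (_ + _ + _).
set e3 := ln r`!%:R - _; set e4 := ln (n - r.*2)`!%:R - _ => b1 b2 b3 b4.
rewrite [X in `|X|](_ : _ = e2 - e1 - e3 - e4); last first.
  by rewrite /e1 /e2 /e3 /e4; field.
apply: (@le_trans _ _ (`|e1| + `|e2| + `|e3| + `|e4|)).
  have := ler_normB (e2 - e1 - e3) e4; have := ler_normB (e2 - e1) e3.
  by have := ler_normB e2 e1; lra.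
by lra.
Qed.

End LucasAsymptotics.

(** * Location of the maximiser and size of the correction *)

Section Maximiser.
Variable R : realType.

(** The form N^2 - 5rN + 5r^2 vanishes at r = mu N, with mu = (1-k)/2, and equals 5x(x - kN). The
    neighbour comparisons bound it by O(N) on both sides, which forces x to be bounded. *)
Lemma lucas_argmax_near (k x : R) (n r : nat) :
  0 < k -> k ^+ 2 = 1 / 5 -> 100 <= n%:R :> R -> (r.*2 <= n)%N ->
  r%:R = (1 - k) / 2 * n%:R + x ->
  ((n - r.*2) * (n - r.*2).-1 <= r.+1 * (n - r.+1))%N ->
  (r * (n - r) <= (n - r.*2).+2 * (n - r.*2).+1)%N ->
  `|x| <= 4.
Proof.
move=> k_gt0 k_sq n_ge le_rn rE.
have n_ge100 : (100 <= n)%N by rewrite -(ler_nat R).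
rewrite -!(ler_nat R) !natrM.
have -> : (n - r.*2)%:R * (n - r.*2).-1%:R =
    (n%:R - 2 * r%:R) * (n%:R - 2 * r%:R - 1) :> R.
  have -> : n%:R - 2 * r%:R = (n - r.*2)%:R :> R by rewrite natrB //
    -mul2n natrM.
  by case: (n - r.*2)%N => [|m]; rewrite ?mul0r //= -addn1 natrD addrK.
have -> : (n - r.+1)%:R = n%:R - r%:R - 1 :> R.
  by rewrite natrB; [rewrite -[r.+1]addn1 natrD opprD addrA | lia].
have -> : r.+1%:R = r%:R + 1 :> R by rewrite -addn1 natrD.
have -> : (n - r)%:R = n%:R - r%:R :> R by rewrite natrB //; lia.
have -> : (n - r.*2).+2%:R = n%:R - 2 * r%:R + 2 :> R.
  by rewrite -addn2 natrD natrB // -mul2n natrM.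
have -> : (n - r.*2).+1%:R = n%:R - 2 * r%:R + 1 :> R.
  by rewrite -addn1 natrD natrB // -mul2n natrM.
have r_ge0 : 0 <= r%:R :> R by [].
have le_rnR : 2 * r%:R <= n%:R :> R by rewrite -natrM ler_nat mul2n.
move: n_ge rE r_ge0 le_rnR; set N : R := n%:R; set r' : R := r%:R.
move=> n_ge rE r_ge0 le_rnR max_lo max_hi.
have quad : N ^+ 2 - 5 * r' * N + 5 * r' ^+ 2 = 5 * x * (x - k * N).
  rewrite rE.
  transitivity ((5 * k ^+ 2 - 1) / 4 * N ^+ 2 + 5 * x * (x - k * N)).
    by field.
  by rewrite k_sq; field.
have lo : 5 * x * (x - k * N) <= 2 * N by rewrite -quad; lra.
have hi : - (5 * x * (x - k * N)) <= 3 * N + 2 by rewrite -quad; lra.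
have /andP[k_lo _] := inv_sqrt5_bounds R k k_gt0 k_sq.
have kN : 44 / 100 * N <= k * N by rewrite ler_wpM2r //; lra.
rewrite ler_norml; apply/andP; split; rewrite leNgt; apply/negP => x_far.
  have : 4 * (k * N) <= - x * (k * N) by rewrite ler_wpM2r //; lra.
  by have := sqr_ge0 x; lra.
(* From 2r <= N follows x <= kN/2, so the second factor is at least kN/2. *)
have : 4 * (k * N / 2) <= x * (k * N - x).
  by apply: ler_pM => //; [lra..|]; lra.
lra.
Qed.

Lemma one_sub_expRN_bounds (w : R) : 0 <= w <= 1 ->
  w / 2 <= 1 - expR (- w) <= w.
Proof.
move=> /andP[w_ge0 w_le1]; apply/andP; split; last first.
  by have := expR_ge1Dx (- w); lra.
suff : expR (- w) <= 1 - w / 2 by lra.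
rewrite expRN; apply: (@le_trans _ _ (1 + w)^-1).
  by rewrite lef_pV2 ?posrE ?expR_gt0 ?expR_ge1Dx //; lra.
by rewrite -[leLHS]mul1r ler_pdivrMr; nra.
Qed.

(** The square is completed at x = 1/10, where the quadratic polynomial has its minimum 17/60 >
    28/100. *)
Lemma quadratic_correction_bounds (k x : R) : 44 / 100 <= k <= 46 / 100 ->
  `|x| <= 4 -> 3 / 10 <= 5 / 2 * k * (5 * x ^+ 2 - x + 1 / 3) <= 100.
Proof.
rewrite ler_norml => /andP[k_lo k_hi] /andP[x_lo x_hi].
have p_lo : 28 / 100 <= 5 * x ^+ 2 - x + 1 / 3.
  by have := sqr_ge0 (x - 1 / 10); rewrite sqrrB; lra.
have p_hi : 5 * x ^+ 2 - x + 1 / 3 <= 85.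
  have : 0 <= (4 - x) * (x + 4) by apply: mulr_ge0; lra.
  by lra.
apply/andP; split; nra.
Qed.

(** For n >= 300000 the error 30000/n^2 is at most 1/(10 n), which turns the bounds 3/10 and 100 of
    the correction into 1/5 and 101. *)
Lemma ln_lucas_coef_argmax_gap (k a : R) (n r : nat) :
  0 < k -> k ^+ 2 = 1 / 5 -> 0 < a -> k * a = (1 + k) / 2 ->
  300 * 1000 <= n%:R :> R -> (r.*2 <= n)%N ->
  (forall r', (r'.*2 <= n)%N -> (lucas_coef n r' <= lucas_coef n r)%N) ->
  1 / 5 / n%:R <=
    n%:R * ln a - ln n%:R / 2 - 3 / 2 * ln k - ln (2 * pi) / 2
    - ln (lucas_coef n r)%:R <= 101 / n%:R.
Proof.
move=> k_gt0 k_sq a_gt0 ka n_big le_rn max_r.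
have [max_lo max_hi] := lucas_coef_argmax n r le_rn max_r.
pose x : R := r%:R - (1 - k) / 2 * n%:R.
have rE : r%:R = (1 - k) / 2 * n%:R + x by rewrite /x; ring.
have n_ge100 : 100 <= n%:R :> R by lra.
have n_gt0 : 0 < n%:R :> R by lra.
have x_le := lucas_argmax_near k x n r k_gt0 k_sq n_ge100 le_rn rE max_lo
  max_hi.
have := ln_lucas_coef_expansion R k a x n r k_gt0 k_sq a_gt0 ka n_ge100 le_rn
  rE x_le.
have k_itv := inv_sqrt5_bounds R k k_gt0 k_sq.
have /andP[] := quadratic_correction_bounds k x k_itv x_le.
set q := 5 / 2 * k * _; set L := ln (lucas_coef n r)%:R.
set M := _ - ln (2 * pi) / 2.
rewrite -exprVn; set Z : R := n%:R^-1.
have Z_gt0 : 0 < Z by rewrite invr_gt0.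
have nZ := ler_wpM2r (ltW Z_gt0) n_big; rewrite [leRHS]mulfV ?gt_eqF // in nZ.
have := ler_wpM2r (ltW Z_gt0) nZ; rewrite -mulrA -expr2 mul1r.
move=> ZZ q_lo q_hi; clearbody q L M; clear -Z_gt0 ZZ q_lo q_hi.
have qZ_lo : 3 / 10 * Z <= q * Z by rewrite ler_pM2r.
have qZ_hi : q * Z <= 100 * Z by rewrite ler_pM2r.
by rewrite ler_norml => /andP[b1 b2]; apply/andP; split; lra.
Qed.
End Maximiser.

(** * The asymptotic formula for the height *)

Theorem corollary1p4 (R : realType) (alpha beta : R)
    (alpha_gt0 : 0 < alpha) (alpha_root : root ('X^2 - 'X - 1) alpha)
    (beta_gt0 : 0 < beta) (beta_root : root (4%:R *: 'X^4 - 125%:R%:P) beta) :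
  two_sided_O
    (fun n : nat =>
       beta / Num.sqrt (n%:R * pi) * alpha ^+ n - (height (Res 2 n))%:~R)
    (fun n : nat => alpha ^+ n / (n%:R * Num.sqrt n%:R)).
Proof.
have alpha_eq : alpha ^+ 2 = alpha + 1.
  by move: alpha_root; rewrite rootE !hornerE => /eqP; lra.
have beta_eq : 4 * beta ^+ 4 = 125.
  by move: beta_root; rewrite rootE !hornerE => /eqP; lra.
have alpha_gt1 : 1 < alpha by nra.
(* Since 2 alpha - 1 = sqrt 5, this is 1/sqrt 5. *)
pose k := (2 * alpha - 1) / 5.
have k_gt0 : 0 < k by rewrite /k; lra.
have k_sq : k ^+ 2 = 1 / 5.
  have -> : k ^+ 2 = (4 * alpha ^+ 2 - 4 * alpha + 1) / 25 by rewrite /k; field.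
  by rewrite alpha_eq; field.
have ka : k * alpha = (1 + k) / 2.
  have -> : k * alpha = (2 * alpha ^+ 2 - alpha) / 5 by rewrite /k; field.
  by rewrite alpha_eq /k; field.
have pi_pos := pi_gt0 R.
(* From 4 beta^4 = 125 and k^6 = 1/125 follows beta = k^(-3/2) / sqrt 2. *)
have ln_beta : ln beta = - (3 / 2 * ln k) - ln 2 / 2.
  have : 2 ^+ 2 * beta ^+ 4 * k ^+ 6 = 1.
    have -> : 2 ^+ 2 * beta ^+ 4 * k ^+ 6 = 4 * beta ^+ 4 * (k ^+ 2) ^+ 3
      by ring.
    by rewrite beta_eq k_sq; field.
  move/(congr1 (@ln R)).
  have p2 : 0 < 2 ^+ 2 :> R by rewrite exprn_gt0.
  have pb : 0 < beta ^+ 4 by rewrite exprn_gt0.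
  have pk : 0 < k ^+ 6 by rewrite exprn_gt0.
  rewrite ln1 lnM ?posrE // ?mulr_gt0 // lnM ?posrE // !lnXn //.
  by lra.
pose c := beta / Num.sqrt pi.
have c_gt0 : 0 < c by rewrite divr_gt0 // sqrtr_gt0.
(* With w the logarithmic gap, 1 - exp(-w) lies between w/2 and w, and w between 1/(5n) and 101/n,
   whence 1/10 and 101. *)
exists (c / 10), (101 * c), (Num.bound (300 * 1000 : R)).
split; [by rewrite divr_gt0 | by rewrite mulr_gt0 |] => n lt_n.
have n_big : 300 * 1000 <= n%:R :> R.
  apply: (@le_trans _ _ (Num.bound (300 * 1000 : R))%:R).
    by rewrite ltW // archi_boundP // mulr_ge0.
  by rewrite ler_nat ltnW.
have n_gt0 : 0 < n%:R :> R by lra.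
have [r [le_rn -> max_r]] := HeightRes.height_Res_quadratic n.
have := ln_lucas_coef_argmax_gap R k alpha n r k_gt0 k_sq alpha_gt0 ka n_big
  le_rn max_r.
rewrite -[_%:~R]/((lucas_coef n r)%:R).
have L_gt0 : 0 < (lucas_coef n r)%:R :> R by rewrite ltr0n lucas_coef_gt0.
set L : R := (lucas_coef n r)%:R in L_gt0 *.
set main := beta / Num.sqrt (n%:R * pi) * alpha ^+ n.
have sqrtn_gt0 : 0 < Num.sqrt n%:R :> R by rewrite sqrtr_gt0.
have sqrtpi_gt0 : 0 < Num.sqrt pi :> R by rewrite sqrtr_gt0.
have mainE : main = c / Num.sqrt n%:R * alpha ^+ n.
  by rewrite /main /c sqrtrM ?ler0n //; field; rewrite !gt_eqF.
have an_gt0 : 0 < alpha ^+ n by rewrite exprn_gt0.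
have main_gt0 : 0 < main by rewrite mainE mulr_gt0 // divr_gt0.
have ln_sqrt (y : R) : 0 < y -> ln (Num.sqrt y) = ln y / 2.
  move=> y_gt0; have := @lnXn R 2 (Num.sqrt y); rewrite sqr_sqrtr ?ltW //
    sqrtr_gt0.
  by move=> /(_ y_gt0) ->; field.
have ln_main : ln main =
    n%:R * ln alpha - ln n%:R / 2 - 3 / 2 * ln k - ln (2 * pi) / 2.
  rewrite mainE lnM ?posrE ?divr_gt0 // ln_div ?posrE // ln_div ?posrE //.
  rewrite lnXn // !ln_sqrt // ln_beta lnM ?posrE // -[_ *+ n]mulr_natl.
  by field.
rewrite -ln_main; set w := ln main - ln L; set Z := (n%:R^-1).
move=> /andP[w_lo w_hi].
have LE : L = main * expR (- w).
  by rewrite /w opprB expRB !lnK ?posrE //; field; rewrite gt_eqF.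
have Z_gt0 : 0 < Z by rewrite invr_gt0.
have Z_small : 300 * 1000 * Z <= 1.
  by have := ler_wpM2r (ltW Z_gt0) n_big; rewrite mulfV // gt_eqF.
have scale : c * (alpha ^+ n / (n%:R * Num.sqrt n%:R)) = main * Z.
  by rewrite mainE /Z; field; rewrite !gt_eqF.
have -> : main - L = main * (1 - expR (- w)) by rewrite LE; ring.
have -> : c / 10 * (alpha ^+ n / (n%:R * Num.sqrt n%:R)) = main * (Z / 10).
  by rewrite mulrAC scale mulrA.
have -> : 101 * c * (alpha ^+ n / (n%:R * Num.sqrt n%:R)) = main * (101 * Z).
  by rewrite -mulrA scale mulrCA.
rewrite !ler_pM2l //; clearbody w; clear -w_lo w_hi Z_gt0 Z_small.
have w_itv : 0 <= w <= 1 by apply/andP; split; lra.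
have /andP[e_lo e_hi] := one_sub_expRN_bounds R w w_itv.
by apply/andP; split; lra.
Qed.
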